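(* For every order $N\ne1$ ($N\ge 2$) and all $n\ge1$, $p\ge0$, $$\operatorname{Ker}(d_H|_{\widetilde\Omega_{n,p}^N})=\operatorname{Ker}(d_H|_{\Omega_{n,p}^N})/\mathcal A_{n,p}^N,$$ where the right-hand side denotes the image of $\operatorname{Ker}(d_H|_{\Omega_{n,p}^N})$ under the quotient map $\Omega_{n,p}^N\to\widetilde\Omega_{n,p}^N=\Omega_{n,p}^N/\mathcal A_{n,p}^N$.
   Context: Aromatic forests. Let $V$ be a finite nonempty set of nodes and $E\subset V\times V$ a set of edges; an edge $(v,w)$ goes from $v$ to $w$ and then $v$ is a predecessor of $w$. Each node is the source of at most one edge; nodes with no outgoing edge are called roots. $V$ is split into vertices $V^\bullet$ and covertices $V^\circ$. The covertices are numbered $1,\dots,p$, the roots are numbered $1,\dots,n$, the vertices are not numbered. Such graphs, up to isomorphism preserving the vertex/covertex type and the numberings of covertices and roots, are called aromatic forests; $\mathcal F_{n,p}^N$ is the set of aromatic forests with $n$ roots, $p$ covertices and exactly $N$ nodes. Aromatic forms. The symmetric groups $S_n^\bullet$ and $S_p^\circ$ act on $\mathcal F_{n,p}^N$ by permuting the numbers of the roots, respectively covertices. Set $\wedge^\bullet\gamma=\frac1{n!}\sum_{\sigma\in S_n^\bullet}\varepsilon(\sigma)\sigma\gamma$, $\wedge^\circ\gamma=\frac1{p!}\sum_{\sigma\in S_p^\circ}\varepsilon(\sigma)\sigma\gamma$, $\wedge=\wedge^\bullet\wedge^\circ$, extended linearly, and $\Omega_{n,p}^N=\wedge\operatorname{Span}_{\mathbb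 R}(\mathcal F_{n,p}^N)$. Horizontal derivative. For a root $r$ and a node $u$ (possibly $u=r$), $D^{r\to u}\gamma$ is $\gamma$ with the edge $(r,u)$ added. For $\gamma\in\mathcal F_{n,p}^N$, $n\ge1$, with root number $n$ denoted $r_n$, $d_H\gamma=\sum_{u\in V}D^{r_n\to u}\gamma$; by linearity $d_H:\Omega_{n,p}^N\to\Omega_{n-1,p}^N$. Divergence-free version. A 1-loop is an edge $(v,v)$ ($v$ any node). Let $\mathcal A$ be the span of aromatic forests containing at least one 1-loop, $\mathcal A_{n,p}^N=\mathcal A\cap\Omega_{n,p}^N$, $\widetilde\Omega_{n,p}^N=\Omega_{n,p}^N/\mathcal A_{n,p}^N$. The map $d_H$ sends $\mathcal A$ to $\mathcal A$ and hence descends to $d_H:\widetilde\Omega_{n,p}^N\to\widetilde\Omega_{n-1,p}^N$. *)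

(* Defs.v *)
From HB Require Import structures.
From mathcomp Require Import all_boot all_order all_fingroup all_algebra.
From mathcomp Require Import generic_quotient ring_quotient.
From mathcomp Require Import classical_sets reals.
Import GRing.Theory.

Set Implicit Arguments.
Unset Strict Implicit.
Unset Printing Implicit Defensive.

Local Open Scope ring_scope.
Local Open Scope quotient_scope.

Section LabelledForests.
Variables N n p : nat.

(* Outgoing edges, roots in the order of their numbers, covertices in the
   order of their numbers; the vertices are the nodes outside the range of the
   third component. Each node has at most one outgoing edge by construction. *)
Definition preforest : Type :=
  ({ffun 'I_N -> option 'I_N} * {ffun 'I_n -> 'I_N} * {ffun 'I_p -> 'I_N})%type.

HB.instance Definition _ := Finite.on preforest.

Definition is_lforest (g : preforest) : bool :=
  [&& injectiveb g.1.2, injectiveb g.2 &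
      [forall v, (g.1.1 v == None) == (v \in codom g.1.2)]].

(* Aromatic forests drawn on the node set 'I_N; isomorphism is quotiented out
   in [forest]. *)
Record lforest := LForest { lforest_val : preforest;
                            lforestP : is_lforest lforest_val }.

HB.instance Definition _ := [isSub for lforest_val].
HB.instance Definition _ := [Finite of lforest by <:].

Definition succ (g : lforest) : {ffun 'I_N -> option 'I_N} :=
  (lforest_val g).1.1.
Definition rootn (g : lforest) : {ffun 'I_n -> 'I_N} := (lforest_val g).1.2.
Definition covn (g : lforest) : {ffun 'I_p -> 'I_N} := (lforest_val g).2.

Lemma rootn_inj g : injective (rootn g).
Proof. by apply/injectiveP; case/and3P: (lforestP g). Qed.

Lemma covn_inj g : injective (covn g).
Proof. by apply/injectiveP; case/and3P: (lforestP g). Qed.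

Lemma succ_root g v : (succ g v == None) = (v \in codom (rootn g)).
Proof. by case/and3P: (lforestP g) => _ _ /forallP/(_ v)/eqP. Qed.

Lemma lforest_eq g h :
  succ g =1 succ h -> rootn g =1 rootn h -> covn g =1 covn h -> g = h.
Proof.
move=> /ffunP e1 /ffunP e2 /ffunP e3; apply: val_inj => /=.
move: e1 e2 e3; rewrite /succ /rootn /covn.
by case: (lforest_val g) (lforest_val h) => [[? ?] ?] [[? ?] ?] /= -> -> ->.
Qed.

Definition iso_by (s : {perm 'I_N}) (g h : lforest) : bool :=
  [&& [forall v, succ h (s v) == omap s (succ g v)],
      [forall i, rootn h i == s (rootn g i)] &
      [forall j, covn h j == s (covn g j)]].

Definition iso (g h : lforest) : bool := [exists s, iso_by s g h].

Lemma iso_byP (s : {perm 'I_N}) g h :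
  reflect [/\ forall v, succ h (s v) = omap s (succ g v),
              forall i, rootn h i = s (rootn g i) &
              forall j, covn h j = s (covn g j)] (iso_by s g h).
Proof.
apply: (iffP and3P) => -[h1 h2 h3]; split.
- by move=> v; apply/eqP/(forallP h1).
- by move=> v; apply/eqP/(forallP h2).
- by move=> v; apply/eqP/(forallP h3).
- by apply/forallP => v; rewrite h1.
- by apply/forallP => v; rewrite h2.
- by apply/forallP => v; rewrite h3.
Qed.

Lemma iso_refl : reflexive iso.
Proof.
move=> g; apply/existsP; exists 1%g; apply/iso_byP.
split=> v; rewrite ?perm1 //; case: (succ g v) => //= w.
by rewrite perm1.
Qed.

Lemma iso_symW g h : iso g h -> iso h g.
Proof.
case/existsP=> s /iso_byP[h1 h2 h3]; apply/existsP; exists (s^-1)%g.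
apply/iso_byP; split=> v; last 2 first.
- by rewrite h2 permK.
- by rewrite h3 permK.
rewrite -{2}[v](permKV s) h1; case: (succ g _) => //= w.
by rewrite permK.
Qed.

Lemma iso_sym : symmetric iso.
Proof. by move=> g h; apply/idP/idP => /iso_symW. Qed.

Lemma iso_trans : transitive iso.
Proof.
move=> h g k /existsP[s /iso_byP[h1 h2 h3]] /existsP[t /iso_byP[k1 k2 k3]].
apply/existsP; exists (s * t)%g; apply/iso_byP; split=> v.
- by rewrite permM k1 h1; case: (succ g v) => //= w; rewrite permM.
- by rewrite k2 h2 permM.
- by rewrite k3 h3 permM.
Qed.

Canonical iso_equiv := EquivRel iso iso_refl iso_sym iso_trans.

Definition forest := {eq_quot iso}.

HB.instance Definition _ := EqQuotient.on forest.
HB.instance Definition _ := Countable.copy forest (can_type (@reprK _ forest)).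
HB.instance Definition _ : isFinite forest := CanIsFinite (@reprK _ forest).

Lemma repr_iso g : exists s, iso_by s (repr (\pi_forest g)) g.
Proof.
by apply/existsP; move/eqmodP: (reprK (\pi_forest g)) => /=.
Qed.

Lemma iso_pi s g h : iso_by s g h -> \pi_forest g = \pi_forest h.
Proof. by move=> gh; apply/eqmodP/existsP; exists s. Qed.

Definition lhas_loop (g : lforest) : bool := [exists v, succ g v == Some v].

Definition has_loop (a : forest) : bool := lhas_loop (repr a).

Lemma iso_has_loop s g h : iso_by s g h -> lhas_loop g -> lhas_loop h.
Proof.
case/iso_byP=> h1 _ _ /existsP[v /eqP gv].
by apply/existsP; exists (s v); rewrite h1 gv.
Qed.

Lemma has_loop_pi g : has_loop (\pi_forest g) = lhas_loop g.
Proof.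
have [s e] := repr_iso g; apply/idP/idP; first exact: iso_has_loop e.
have /iso_symW/existsP[t] : iso (repr (\pi_forest g)) g.
  by apply/existsP; exists s.
exact: iso_has_loop.
Qed.

Lemma permute_roots_subproof (s : 'S_n) g :
  is_lforest (succ g, [ffun i => rootn g ((s^-1)%g i)], covn g).
Proof.
apply/and3P; split=> /=.
- by apply/injectiveP => i j; rewrite !ffunE => /rootn_inj/perm_inj.
- by apply/injectiveP; apply: covn_inj.
apply/forallP => v; rewrite succ_root; apply/eqP.
apply/codomP/codomP => -[i ->]; first by exists (s i); rewrite ffunE permK.
by exists ((s^-1)%g i); rewrite ffunE.
Qed.

(* The root numbered i becomes the root numbered s i. *)
Definition lpermute_roots s g := LForest (permute_roots_subproof s g).

Definition permute_roots s (a : forest) : forest :=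
  \pi_forest (lpermute_roots s (repr a)).

Lemma permute_covertices_subproof (s : 'S_p) g :
  is_lforest (succ g, rootn g, [ffun j => covn g ((s^-1)%g j)]).
Proof.
case/and3P: (lforestP g) => h1 h2 h3; apply/and3P; split=> //=.
by apply/injectiveP => i j; rewrite !ffunE => /covn_inj/perm_inj.
Qed.

Definition lpermute_covertices s g := LForest (permute_covertices_subproof s g).

Definition permute_covertices s (a : forest) : forest :=
  \pi_forest (lpermute_covertices s (repr a)).

Lemma permute_roots_pi s g :
  permute_roots s (\pi_forest g) = \pi_forest (lpermute_roots s g).
Proof.
have [t /iso_byP[h1 h2 h3]] := repr_iso g; apply: (@iso_pi t).
apply/iso_byP; split=> // i.
by rewrite /rootn /= !ffunE h2.
Qed.

Lemma permute_covertices_pi s g :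
  permute_covertices s (\pi_forest g) = \pi_forest (lpermute_covertices s g).
Proof.
have [t /iso_byP[h1 h2 h3]] := repr_iso g; apply: (@iso_pi t).
apply/iso_byP; split=> // i.
by rewrite /covn /= !ffunE h3.
Qed.

Lemma permute_rootsM s t a :
  permute_roots s (permute_roots t a) = permute_roots (t * s)%g a.
Proof.
rewrite {2}/permute_roots permute_roots_pi; congr (\pi _); apply: lforest_eq => // i.
by rewrite /rootn /= !ffunE invMg permM.
Qed.

Lemma permute_rootsC s t a :
  permute_roots s (permute_covertices t a) =
  permute_covertices t (permute_roots s a).
Proof.
rewrite {1}/permute_covertices {2}/permute_roots.
rewrite permute_roots_pi permute_covertices_pi; congr (\pi _).
by apply: lforest_eq.
Qed.

End LabelledForests.

Section AddEdge.
Variables N n p : nat.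
Implicit Types (g : lforest N n.+1 p) (u : 'I_N).

Lemma add_edge_subproof u g :
  is_lforest ([ffun v => if v == rootn g ord_max then Some u else succ g v],
              [ffun i => rootn g (lift ord_max i)], covn g).
Proof.
apply/and3P; split=> /=.
- by apply/injectiveP => i j; rewrite !ffunE => /rootn_inj/lift_inj.
- by apply/injectiveP; apply: covn_inj.
apply/forallP => v; rewrite ffunE; apply/eqP.
case: (eqVneq v (rootn g ord_max)) => [->|nv]; last rewrite succ_root.
  apply/esym/negbTE/codomP => -[i]; rewrite ffunE => /rootn_inj /eqP.
  by rewrite (negbTE (neq_lift _ _)).
apply/codomP/codomP => -[i vi]; last by exists (lift ord_max i); rewrite vi ffunE.
case: (unliftP ord_max i) vi nv => [j|] -> vi; last by rewrite vi eqxx.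
by exists j; rewrite ffunE.
Qed.

(* The root with the largest number gets an edge to u; the other roots keep
   their numbers. *)
Definition ladd_edge u g : lforest N n p := LForest (add_edge_subproof u g).

Lemma iso_ladd_edge s g h u : iso_by s g h ->
  iso_by s (ladd_edge u g) (ladd_edge (s u) h).
Proof.
case/iso_byP=> h1 h2 h3; apply/iso_byP; split=> // v; rewrite /succ /rootn /= !ffunE.
- by rewrite h2 (inj_eq perm_inj); case: eqP.
- by rewrite h2.
Qed.

Lemma ladd_edge_has_loop u g : lhas_loop g -> lhas_loop (ladd_edge u g).
Proof.
case/existsP=> v gv; apply/existsP; exists v; rewrite /succ /= ffunE.
have [vr|//] := eqVneq v (rootn g ord_max).
by move: gv; have := succ_root g v; rewrite {2}vr codom_f => /eqP ->.
Qed.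

Lemma lpermute_roots_ladd_edge (t : 'S_n) u g :
  lpermute_roots t (ladd_edge u g) =
  ladd_edge u (lpermute_roots (lift_perm ord_max ord_max t) g).
Proof.
apply: lforest_eq => // v; rewrite /succ /rootn /= !ffunE lift_permV.
  by rewrite lift_perm_id.
by rewrite lift_perm_lift.
Qed.

End AddEdge.

Definition span (R : realType) (F : finType) : vectType R := {ffun F -> R^o}.

HB.lock Definition basis (R : realType) (F : finType) (a : F) : span R F :=
  [ffun b => (b == a)%:R].

Section Span.
Variable R : realType.

Local Notation span := (span R).
Local Notation basis := (@basis R _).

Section LinearExtension.
Variables (F : finType) (V : vectType R) (f : F -> V).

Definition linext_fun (x : span F) : V := \sum_a (x a : R) *: f a.

Lemma linext_is_linear : linear linext_fun.
Proof.
move=> c x y; rewrite /linext_fun scaler_sumr -big_split /=.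
by apply: eq_bigr => a _; rewrite !ffunE scalerDl scalerA.
Qed.

HB.instance Definition _ :=
  GRing.isLinear.Build R (span F) V _ linext_fun linext_is_linear.

Definition linext : 'Hom(span F, V) := linfun linext_fun.

Lemma linext_basis a : linext (basis a) = f a.
Proof.
rewrite lfunE /= /linext_fun basis.unlock (bigD1 a) //= ffunE eqxx scale1r.
by rewrite big1 ?addr0 // => b /negbTE ba; rewrite ffunE ba scale0r.
Qed.

End LinearExtension.

Lemma span_basis (F : finType) (x : span F) : x = \sum_a (x a : R) *: basis a.
Proof.
apply/ffunP => b; rewrite basis.unlock sum_ffunE (bigD1 b) //= !ffunE eqxx.
rewrite big1 => [|a /negbTE ab].
  by rewrite addr0 /GRing.scale /= mulr1.
by rewrite !ffunE eq_sym ab /GRing.scale /= mulr0.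
Qed.

Lemma eq_span (F : finType) (V : vectType R) (f g : 'Hom(span F, V)) :
  (forall a, f (basis a) = g (basis a)) -> f = g.
Proof.
move=> fg; apply/lfunP => x; rewrite [x]span_basis !linear_sum.
by apply: eq_bigr => a _; rewrite !linearZ /= fg.
Qed.

Lemma eq_span2 (F : finType) (V W U : vectType R) (f : 'Hom(V, U))
    (g : 'Hom(span F, V)) (h : 'Hom(W, U)) (k : 'Hom(span F, W)) :
  (forall a, f (g (basis a)) = h (k (basis a))) -> forall x, f (g x) = h (k x).
Proof.
move=> fg x; have /lfunP/(_ x) : (f \o g = h \o k)%VF.
  by apply: eq_span => a; rewrite !comp_lfunE fg.
by rewrite !comp_lfunE.
Qed.

Definition wedge_roots N n p : 'End(span (forest N n p)) :=
  linext (fun a => (n`!%:R)^-1 *: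
    \sum_(s : 'S_n) (-1) ^+ s *: basis (permute_roots s a)).

Definition wedge_covertices N n p : 'End(span (forest N n p)) :=
  linext (fun a => (p`!%:R)^-1 *:
    \sum_(s : 'S_p) (-1) ^+ s *: basis (permute_covertices s a)).

Definition wedge N n p : 'End(span (forest N n p)) :=
  (wedge_roots N n p \o wedge_covertices N n p)%VF.

Definition Omega N n p : {vspace span (forest N n p)} := limg (wedge N n p).

(* The sum over the nodes does not depend on the choice of [repr a]: see
   [dHspan_pi]. *)
Definition dHspan N n p : 'Hom(span (forest N n.+1 p), span (forest N n p)) :=
  linext (fun a : forest N n.+1 p =>
    \sum_(u : 'I_N) basis (\pi_(forest N n p) (ladd_edge u (repr a)))).

Definition loops N n p : {vspace span (forest N n p)} :=
  <<[seq basis a | a in @has_loop N n p]>>%VS.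

Lemma dHspan_pi N n p (g : lforest N n.+1 p) :
  dHspan N n p (basis (\pi_(forest N n.+1 p) g)) =
  \sum_(u : 'I_N) basis (\pi_(forest N n p) (ladd_edge u g)).
Proof.
rewrite linext_basis; have [s gs] := repr_iso g.
rewrite [RHS](reindex_inj (@perm_inj _ s)) /=; apply: eq_bigr => u _.
by congr (basis _); apply: iso_pi (iso_ladd_edge u gs).
Qed.

Definition act_roots N n p (s : 'S_n) : 'End(span (forest N n p)) :=
  linext (fun a => basis (permute_roots s a)).

Definition act_covertices N n p (s : 'S_p) : 'End(span (forest N n p)) :=
  linext (fun a => basis (permute_covertices s a)).

Lemma act_roots_basis N n p (s : 'S_n) a :
  act_roots N p s (basis a) = basis (permute_roots s a).
Proof. exact: linext_basis. Qed.

Lemma act_covertices_basis N n p (s : 'S_p) a :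
  act_covertices N n s (basis a) = basis (permute_covertices s a).
Proof. exact: linext_basis. Qed.

Lemma wedge_rootsE N n p :
  wedge_roots N n p = (n`!%:R)^-1 *: \sum_(s : 'S_n) (-1) ^+ s *: act_roots N p s.
Proof.
apply: eq_span => a; rewrite linext_basis scale_lfunE sum_lfunE; congr (_ *: _).
by apply: eq_bigr => s _; rewrite scale_lfunE (act_roots_basis s a).
Qed.

Lemma wedge_coverticesE N n p :
  wedge_covertices N n p =
  (p`!%:R)^-1 *: \sum_(s : 'S_p) (-1) ^+ s *: act_covertices N n s.
Proof.
apply: eq_span => a; rewrite linext_basis scale_lfunE sum_lfunE; congr (_ *: _).
by apply: eq_bigr => s _; rewrite scale_lfunE (act_covertices_basis s a).
Qed.

Lemma act_rootsM N n p (s t : 'S_n) x :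
  act_roots N p s (act_roots N p t x) = act_roots N p (t * s)%g x.
Proof.
rewrite -[RHS]id_lfunE; move: x; apply: eq_span2 => a.
by rewrite id_lfunE (act_roots_basis t) !act_roots_basis permute_rootsM.
Qed.

Lemma act_wedge_roots N n p (t : 'S_n) x :
  act_roots N p t (wedge_roots N n p x) = (-1) ^+ t *: wedge_roots N n p x.
Proof.
rewrite wedge_rootsE !scale_lfunE !sum_lfunE linearZ /= linear_sum scalerA mulrC -scalerA.
congr (_ *: _); rewrite scaler_sumr [RHS](reindex_inj (mulIg t)) /=.
apply: eq_bigr => s _; rewrite !scale_lfunE linearZ /= act_rootsM scalerA.
by rewrite odd_permM signr_addb mulrCA -expr2 sqrr_sign mulr1.
Qed.

Lemma act_rootsC N n p (s : 'S_n) (t : 'S_p) x :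
  act_roots N p s (act_covertices N n t x) = act_covertices N n t (act_roots N p s x).
Proof.
move: x; apply: eq_span2 => a.
rewrite (act_covertices_basis t a) (act_roots_basis s a) (act_roots_basis s).
by rewrite (act_covertices_basis t) permute_rootsC.
Qed.

Lemma wedgeC N n p x :
  wedge_roots N n p (wedge_covertices N n p x) =
  wedge_covertices N n p (wedge_roots N n p x).
Proof.
rewrite wedge_rootsE wedge_coverticesE !scale_lfunE !linearZ /= scalerA mulrC -scalerA.
congr (_ *: (_ *: _)); rewrite !sum_lfunE.
rewrite (eq_bigr (fun s : 'S_n => \sum_(t : 'S_p) (-1) ^+ s *: ((-1) ^+ t *:
          act_roots N p s (act_covertices N n t x)))) => [|s _].
  rewrite exchange_big /=; apply: eq_bigr => t _.
  rewrite scale_lfunE linear_sum scaler_sumr; apply: eq_bigr => s _.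
  by rewrite !scale_lfunE !linearZ /= act_rootsC !scalerA mulrC.
rewrite scale_lfunE linear_sum scaler_sumr; apply: eq_bigr => t _.
by rewrite scale_lfunE linearZ.
Qed.

Lemma act_roots_dHspan N n p (t : 'S_n) x :
  act_roots N p t (dHspan N n p x) =
  dHspan N n p (act_roots N p (lift_perm ord_max ord_max t) x).
Proof.
move: x; apply: eq_span2 => a.
rewrite -[a]reprK (act_roots_basis (lift_perm ord_max ord_max t)).
rewrite permute_roots_pi !dHspan_pi linear_sum; apply: eq_bigr => u _.
by rewrite /= act_roots_basis permute_roots_pi lpermute_roots_ladd_edge.
Qed.

Lemma act_covertices_dHspan N n p (t : 'S_p) x :
  act_covertices N n t (dHspan N n p x) = dHspan N n p (act_covertices N n.+1 t x).
Proof.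
move: x; apply: eq_span2 => a.
rewrite -[a]reprK (act_covertices_basis t).
rewrite permute_covertices_pi !dHspan_pi linear_sum; apply: eq_bigr => u _.
rewrite /= act_covertices_basis permute_covertices_pi; congr (basis (\pi_(forest N n p) _)).
by apply: lforest_eq.
Qed.

Lemma wedge_covertices_dHspan N n p x :
  wedge_covertices N n p (dHspan N n p x) =
  dHspan N n p (wedge_covertices N n.+1 p x).
Proof.
rewrite !wedge_coverticesE !scale_lfunE linearZ /=; congr (_ *: _).
rewrite !sum_lfunE linear_sum; apply: eq_bigr => s _.
by rewrite !scale_lfunE linearZ /= act_covertices_dHspan.
Qed.

Lemma wedge_roots_dHspan N n p x :
  wedge_roots N n p (dHspan N n p (wedge_roots N n.+1 p x)) =
  dHspan N n p (wedge_roots N n.+1 p x).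
Proof.
rewrite {1}wedge_rootsE scale_lfunE sum_lfunE.
rewrite (eq_bigr (fun=> dHspan N n p (wedge_roots N n.+1 p x))) => [|s _].
  rewrite sumr_const card_Sn -scaler_nat scalerA mulVf ?scale1r //.
  by rewrite Num.Theory.pnatr_eq0 -lt0n fact_gt0.
rewrite scale_lfunE act_roots_dHspan act_wedge_roots linearZ /= scalerA.
by rewrite odd_lift_perm /= addbb -expr2 sqrr_sign scale1r.
Qed.

Lemma dHspan_Omega N n p x :
  x \in Omega N n.+1 p -> dHspan N n p x \in Omega N n p.
Proof.
case/memv_imgP=> y _ ->; apply/memv_imgP.
exists (dHspan N n p (wedge_roots N n.+1 p y)); first exact: memvf.
by rewrite !comp_lfunE wedge_covertices_dHspan -wedgeC wedge_roots_dHspan.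
Qed.

Lemma dHspan_loops N n p x :
  x \in loops N n.+1 p -> dHspan N n p x \in loops N n p.
Proof.
suff : (loops N n.+1 p <= dHspan N n p @^-1: loops N n p)%VS.
  by move=> /subvP h /h; rewrite -memv_preim.
apply/span_subvP => y /mapP[a]; rewrite mem_enum => la ->; rewrite -memv_preim linext_basis.
apply: memv_suml => u _; apply: memv_span; apply: map_f.
by rewrite mem_enum; apply: etrans (has_loop_pi _) (ladd_edge_has_loop u la).
Qed.

Definition aromatic_form N n p : vectType R := subvs_of (Omega N n p).

Definition dH N n p (w : aromatic_form N n.+1 p) : aromatic_form N n p :=
  Subvs (dHspan_Omega (subvsP w)).

Lemma dH_is_linear N n p : linear (@dH N n p).
Proof. by move=> c x y; apply: val_inj; rewrite /= !linearP. Qed.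

HB.instance Definition _ N n p := GRing.isLinear.Build R
  (aromatic_form N n.+1 p) (aromatic_form N n p) _ (@dH N n p)
  (@dH_is_linear N n p).

(* A_{n,p}^N, as a subspace of the space of aromatic forms. *)
Definition loop_form N n p : {vspace aromatic_form N n p} :=
  (linfun (vsval : aromatic_form N n p -> span (forest N n p))
     @^-1: (loops N n p :&: Omega N n p))%VS.

Lemma mem_loop_form N n p (w : aromatic_form N n p) :
  (w \in loop_form N n p) = (vsval w \in loops N n p).
Proof. by rewrite -memv_preim lfunE /= memv_cap subvsP andbT. Qed.

Lemma dH_loop_form N n p (w : aromatic_form N n.+1 p) :
  w \in loop_form N n.+1 p -> dH w \in loop_form N n p.
Proof. by rewrite !mem_loop_form; apply: dHspan_loops. Qed.

End Span.

Section QuotientSpace.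
Variables (K : fieldType) (vT : vectType K) (U : {vspace vT}).

Definition quotv : Type := Quotient.quot (pred_of_vspace U).

HB.instance Definition _ := GRing.Zmodule.on quotv.
HB.instance Definition _ := EqQuotient.on quotv.

Lemma quotv_eqP (x y : vT) : reflect (\pi_quotv x = \pi_quotv y) (x - y \in U).
Proof.
have -> : (x - y \in U) = (\pi_quotv x == \pi_quotv y) by rewrite -Quotient.idealrBE.
exact: eqP.
Qed.

Lemma quotvD (x y : vT) : \pi_quotv (x + y) = \pi_quotv x + \pi_quotv y.
Proof. exact: Quotient.pi_add. Qed.

Definition scaleq (c : K) (x : quotv) : quotv := \pi_quotv (c *: repr x).

Lemma scaleq_pi c (x : vT) : scaleq c (\pi_quotv x) = \pi_quotv (c *: x).
Proof. by apply/quotv_eqP; rewrite -scalerBr memvZ //; apply/quotv_eqP; rewrite reprK. Qed.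

Lemma quotvP (x : quotv) : exists v : vT, x = \pi_quotv v.
Proof. by exists (repr x); rewrite reprK. Qed.

Lemma scaleqA a b (x : quotv) : scaleq a (scaleq b x) = scaleq (a * b) x.
Proof. by have [v ->] := quotvP x; rewrite !scaleq_pi scalerA. Qed.

Lemma scale1q : left_id 1 scaleq.
Proof. by move=> x; have [v ->] := quotvP x; rewrite scaleq_pi scale1r. Qed.

Lemma scaleqDr : right_distributive scaleq +%R.
Proof.
move=> a x y; have [v ->] := quotvP x; have [w ->] := quotvP y.
by rewrite -quotvD !scaleq_pi -quotvD scalerDr.
Qed.

Lemma scaleqDl (x : quotv) : {morph scaleq^~ x : a b / a + b}.
Proof.
by move=> a b; have [v ->] := quotvP x; rewrite !scaleq_pi scalerDl quotvD.
Qed.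

HB.instance Definition _ := GRing.Zmodule_isLmodule.Build K quotv
  scaleqA scale1q scaleqDr scaleqDl.

End QuotientSpace.

Section DivergenceFree.
Variable R : realType.

(* The quotients of the spaces of aromatic forms by the forms in the span of
   the forests with a 1-loop, the projections, and the induced derivative. *)
Definition df_form N n p : lmodType R := quotv (loop_form R N n p).

Definition df_pi N n p (w : aromatic_form R N n p) : df_form N n p :=
  \pi_(quotv (loop_form R N n p)) w.

Definition dH_df N n p (x : df_form N n.+1 p) : df_form N n p :=
  df_pi (dH (repr (x : quotv (loop_form R N n.+1 p)))).

Lemma dH_df_pi N n p (w : aromatic_form R N n.+1 p) :
  dH_df (df_pi w) = df_pi (dH w).
Proof.
apply/quotv_eqP; rewrite -linearB dH_loop_form //.
by apply/quotv_eqP; rewrite reprK.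
Qed.

Lemma df_pi_is_linear N n p : linear (@df_pi N n p).
Proof. by move=> c x y; rewrite /df_pi quotvD -scaleq_pi. Qed.

HB.instance Definition _ N n p := GRing.isLinear.Build R
  (aromatic_form R N n p) (df_form N n p) _ (@df_pi N n p)
  (@df_pi_is_linear N n p).

Lemma df_pi_eq0 N n p (w : aromatic_form R N n p) :
  (df_pi w == 0) = (w \in loop_form R N n p).
Proof.
rewrite -[w in RHS]subr0 -(linear0 (@df_pi N n p)).
by apply/eqP/quotv_eqP.
Qed.

Lemma df_pi_surj N n p (x : df_form N n p) : exists w, x = df_pi w.
Proof. by exists (repr (x : quotv (loop_form R N n p))); rewrite /df_pi reprK. Qed.

Lemma dH_df_is_linear N n p : linear (@dH_df N n p).
Proof.
move=> c x y; have [v ->] := df_pi_surj x; have [w ->] := df_pi_surj y.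
by rewrite -linearP !dH_df_pi !linearP.
Qed.

HB.instance Definition _ N n p := GRing.isLinear.Build R
  (df_form N n.+1 p) (df_form N n p) _ (@dH_df N n p) (@dH_df_is_linear N n p).

End DivergenceFree.

(* Main.v *)
Require Import Defs.
From mathcomp Require Import all_boot all_order all_fingroup all_algebra.
From mathcomp Require Import classical_sets reals.
From mathcomp Require Import generic_quotient.
Import GRing.Theory Num.Theory.

Set Implicit Arguments.
Unset Strict Implicit.
Unset Printing Implicit Defensive.

Local Open Scope ring_scope.

(** Forests are handled through drawings on the node set 'I_N, and forms
through functions X on drawings. A form w is lifted to such a function that is
alternating in the numbers of the roots and invariant under isomorphism
([push_surj]); on functions, d_H becomes the operator [dfun],
  (dfun X)(g) = sum over the non-root nodes v of X(g with the edge out of v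
                removed and v made the last root)
([push_dfun]).

Modulo loops, each node v carries a two-term complex R -> R^(N-1): in degree 1
the node is a root, in degree 0 it points to one of the N-1 other nodes, and the
differential sends the state root to the sum of all the targets. The complex of
loopless drawings is the graded tensor product of these over the nodes. Since
N >= 2 each factor has injective differential, so the homology of the product
lies in degree 0: a function on drawings with at least one root, killed by
dfun on loopless drawings, is dfun of some Z there ([dfun_exact_loopless]).

Now let w have at least one root, with d_H w in the span of the forests with a
1-loop. By exactness w is congruent to d_H z modulo loops for some form z
([dHspan_exact_mod_loops]). Then d_H z has the same class as w in the quotient,
and it is d_H-closed because d_H d_H = 0 ([dHspan_dHspan]): it is the required
closed representative. *)

(** * Permutations and drawings *)

Lemma perm_fixing_max n (s : 'S_n.+1) :
  s ord_max = ord_max -> exists t : 'S_n, s = lift_perm ord_max ord_max t.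
Proof.
move=> smax.
have s_lift i : {j | s (lift ord_max i) = lift ord_max j}.
  case: (unliftP ord_max (s (lift ord_max i))) => [j ->|]; first by exists j.
  rewrite -[in RHS]smax => /perm_inj /eqP.
  by rewrite eq_sym (negbTE (neq_lift _ _)).
have t_inj : injective (fun i => sval (s_lift i)).
  move=> i j; case: (s_lift i) => /= i' ei; case: (s_lift j) => /= j' ej e.
  by apply: (@lift_inj _ ord_max); apply: (@perm_inj _ s); rewrite ei ej e.
exists (perm t_inj); apply/permP => i.
case: (unliftP ord_max i) => [j|] ->; last by rewrite lift_perm_id.
by rewrite lift_perm_lift permE; case: (s_lift j).
Qed.

Section RawForests.
Variables N p : nat.
Local Notation preforest n := (preforest N n p).

(** Drawings are raw triples with no validity condition, so that [attach],
[detach] and [renumber] are total and compose without proof obligations;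
validity is a hypothesis only where it matters. *)
Definition attach n u (g : preforest n.+1) : preforest n :=
  ([ffun v => if v == g.1.2 ord_max then Some u else g.1.1 v],
   [ffun i => g.1.2 (lift ord_max i)], g.2).

Definition detach n w (g : preforest n) : preforest n.+1 :=
  ([ffun v => if v == w then None else g.1.1 v],
   [ffun i => if unlift ord_max i is Some j then g.1.2 j else w], g.2).

Definition renumber n (s : 'S_n) (g : preforest n) : preforest n :=
  (g.1.1, [ffun i => g.1.2 ((s^-1)%g i)], g.2).

Definition loopless n (g : preforest n) :=
  is_lforest g && [forall v, g.1.1 v != Some v].

Lemma preforest_eq n (g h : preforest n) :
  g.1.1 =1 h.1.1 -> g.1.2 =1 h.1.2 -> g.2 = h.2 -> g = h.
Proof.
case: g h => [[e r] c] [[e' r'] c'] /= ee er ec.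
by congr (_, _, _) => //; apply/ffunP.
Qed.

Lemma last_root_detach n w (g : preforest n) : (detach w g).1.2 ord_max = w.
Proof. by rewrite ffunE unlift_none. Qed.

Lemma lift_root_detach n w (g : preforest n) i :
  (detach w g).1.2 (lift ord_max i) = g.1.2 i.
Proof. by rewrite ffunE liftK. Qed.

Lemma renumberM n (s t : 'S_n) g :
  renumber s (renumber t g) = renumber (t * s)%g g.
Proof. by apply: preforest_eq => // i; rewrite !ffunE invMg permM. Qed.

Lemma renumber1 n (g : preforest n) : renumber 1 g = g.
Proof. by apply: preforest_eq => // i; rewrite !ffunE invg1 perm1. Qed.

Lemma renumber_attach n (t : 'S_n) u g :
  renumber t (attach u g) =
  attach u (renumber (lift_perm ord_max ord_max t) g).
Proof.
apply: preforest_eq => // i; rewrite !ffunE lift_permV.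
  by rewrite lift_perm_id.
by rewrite lift_perm_lift.
Qed.

Lemma detach_renumber n (t : 'S_n) w g :
  detach w (renumber t g) =
  renumber (lift_perm ord_max ord_max t) (detach w g).
Proof.
apply: preforest_eq => // i; rewrite !ffunE lift_permV.
case: (unliftP ord_max i) => [j|] ->.
  by rewrite ffunE lift_perm_lift liftK.
by rewrite lift_perm_id unlift_none.
Qed.

Lemma attach_detach n u w (g : preforest n) :
  g.1.1 w = Some u -> attach u (detach w g) = g.
Proof.
move=> gw; apply: preforest_eq => // v; rewrite ffunE.
  by rewrite last_root_detach; case: eqP => [->|/eqP/negbTE vw] //; rewrite ffunE vw.
exact: lift_root_detach.
Qed.

Lemma detach_attach n u (g : preforest n.+1) :
  is_lforest g -> detach (g.1.2 ord_max) (attach u g) = g.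
Proof.
move=> hg; apply: preforest_eq => // v; rewrite !ffunE.
  case: eqP => [->|//]; apply/esym/eqP.
  by rewrite (succ_root (LForest hg)) codom_f.
by case: (unliftP ord_max v) => [j|] ->; rewrite ?ffunE.
Qed.

(** Detaching two nodes in either order gives drawings that differ by the
transposition of the last two root numbers ([swap_detach2]). *)
Definition swap_last n : 'S_n.+2 := tperm ord_max (lift ord_max ord_max).

Lemma odd_swap_last n : swap_last n = true :> bool.
Proof. by rewrite odd_tperm neq_lift. Qed.

Lemma swap_lastV n : ((swap_last n)^-1 = swap_last n)%g.
Proof. exact: tpermV. Qed.

Lemma swap_last_lift n (i : 'I_n) :
  swap_last n (lift ord_max (lift ord_max i)) = lift ord_max (lift ord_max i).
Proof.
by rewrite tpermD ?(inj_eq (@lift_inj _ _)) ?neq_lift.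
Qed.

Lemma attach_swap_detach n u w (g : preforest n.+1) : w != g.1.2 ord_max ->
  attach u (renumber (swap_last n) (detach w g)) = detach w (attach u g).
Proof.
move=> wr; apply: preforest_eq => // v; rewrite !ffunE swap_lastV.
  rewrite tpermL liftK.
  by case: (eqVneq v w) => // ->; rewrite (negbTE wr).
case: (unliftP ord_max v) => [j|] ->.
  by rewrite swap_last_lift liftK ffunE.
by rewrite tpermR unlift_none.
Qed.

Lemma swap_detach2 n w w' (g : preforest n) :
  renumber (swap_last n) (detach w (detach w' g)) = detach w' (detach w g).
Proof.
apply: preforest_eq => // v; rewrite !ffunE ?swap_lastV.
  by case: eqP; case: eqP.
case: (unliftP ord_max v) => [j|] ->.
  case: (unliftP ord_max j) => [i|] ->.
    by rewrite swap_last_lift !liftK !ffunE !liftK.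
  by rewrite tpermR unlift_none ffunE unlift_none.
by rewrite tpermL liftK ffunE unlift_none.
Qed.

Lemma is_lforest_attach n u (g : preforest n.+1) :
  is_lforest g -> is_lforest (attach u g).
Proof. by move=> hg; apply: (lforestP (ladd_edge u (LForest hg))). Qed.

Lemma is_lforest_renumber n (s : 'S_n) (g : preforest n) :
  is_lforest g -> is_lforest (renumber s g).
Proof. by move=> hg; apply: (lforestP (lpermute_roots s (LForest hg))). Qed.

Lemma is_lforest_detach n w (g : preforest n) :
  is_lforest g -> g.1.1 w != None -> is_lforest (detach w g).
Proof.
move=> hg; rewrite (succ_root (LForest hg)) => wr.
case/and3P: (hg) => /injectiveP ir ic _; apply/and3P; split=> //.
  apply/injectiveP => i j.
  case: (unliftP ord_max i) => [i'|] ->; case: (unliftP ord_max j) => [j'|] ->;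
    rewrite ?lift_root_detach ?last_root_detach //.
  - by move/ir ->.
  - by move=> e; case/negP: wr; rewrite -e; apply: (codom_f g.1.2).
  - by move=> e; case/negP: wr; rewrite e; apply: (codom_f g.1.2).
apply/forallP => v; rewrite ffunE; apply/eqP; have [->|vw] := eqVneq v w.
  by rewrite -{1}(last_root_detach w g) eqxx; apply/esym; apply: codom_f.
rewrite (succ_root (LForest hg)); apply/codomP/codomP => -[i vi].
  by exists (lift ord_max i); rewrite lift_root_detach.
case: (unliftP ord_max i) vi vw => [j|] -> ->.
  by rewrite lift_root_detach; exists j.
by rewrite last_root_detach => /eqP.
Qed.

Lemma loopless_detach n w (g : preforest n) :
  loopless g -> g.1.1 w != None -> loopless (detach w g).
Proof.
case/andP=> hg /forallP lg gw; rewrite /loopless is_lforest_detach //=.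
by apply/forallP => v; rewrite ffunE; case: (v == w).
Qed.

Lemma loopless_renumber n (s : 'S_n) (g : preforest n) :
  loopless g -> loopless (renumber s g).
Proof. by case/andP=> hg lg; rewrite /loopless is_lforest_renumber. Qed.

Lemma loopless_attach n u (g : preforest n.+1) :
  u != g.1.2 ord_max -> loopless g -> loopless (attach u g).
Proof.
move=> ur /andP[hg /forallP lg]; rewrite /loopless is_lforest_attach //=.
apply/forallP => v; rewrite ffunE; case: (eqVneq v _) => // ->.
by apply: contra ur => /eqP[->].
Qed.

(** * The complex of alternating functions on drawings *)

Section Cochains.
Variable R : numDomainType.

Definition alternating n (X : preforest n -> R) :=
  forall (s : 'S_n) g, is_lforest g -> X (renumber s g) = (-1) ^+ s * X g.

Definition dfun n (X : preforest n.+1 -> R) (g : preforest n) : R :=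
  \sum_(w | g.1.1 w != None) X (detach w g).

Lemma alternating_dfun n (X : preforest n.+1 -> R) :
  alternating X -> alternating (dfun X).
Proof.
move=> aX s g hg; rewrite mulr_sumr; apply: eq_bigr => w gw.
rewrite detach_renumber aX ?is_lforest_detach //.
by rewrite odd_lift_perm /= addbb.
Qed.

(** The double sum runs over ordered pairs of nodes, and exchanging the two nodes
swaps the last two roots, so that the sum is its own opposite. *)
Lemma dfun_dfun n (X : preforest n.+2 -> R) g :
  alternating X -> is_lforest g -> dfun (dfun X) g = 0.
Proof.
move=> aX hg; suff: dfun (dfun X) g == - dfun (dfun X) g.
  by rewrite -addr_eq0 -mulr2n mulrn_eq0 => /eqP.
apply/eqP.
have dfun2E : dfun (dfun X) g = \sum_(w | g.1.1 w != None)
    \sum_(w' | (g.1.1 w' != None) && (w' != w)) X (detach w' (detach w g)).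
  apply: eq_bigr => w _; apply: eq_bigl => w'.
  by rewrite ffunE; case: (eqVneq w' w); rewrite ?andbT ?andbF.
rewrite {1}dfun2E (exchange_big_dep (fun w => g.1.1 w != None)) => [|w w' _ /andP[] //].
rewrite dfun2E -sumrN; apply: eq_bigr => w gw; rewrite -sumrN.
apply: eq_big => [w'|w']; first by rewrite gw /= (eq_sym w).
case/andP=> gw' /andP[_ ww'].
rewrite -swap_detach2 aX ?odd_swap_last ?mulN1r //.
apply: is_lforest_detach; first by apply: is_lforest_detach.
by rewrite ffunE [w' == w]eq_sym (negbTE ww').
Qed.

Section Contraction.
Variables u v : 'I_N.

(** A contracting homotopy for the factor of the node v, u being a fixed target:
a drawing in which v points to u is sent to the one where v is a root, and those
where v points elsewhere to 0. The node v is first given the last root number;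
the sign makes the choice of the renumbering irrelevant for alternating
functions. *)
Definition contract n (Y : preforest n -> R) (g : preforest n.+1) : R :=
  if [pick s : 'S_n.+1 | (renumber s g).1.2 ord_max == v] is Some s
  then (-1) ^+ s * Y (attach u (renumber s g)) else 0.

(** Two renumberings that bring v to the last place differ by a permutation of
the other roots, which commutes with [attach]. *)
Lemma contractE n (Y : preforest n -> R) (s : 'S_n.+1) g :
    alternating Y -> is_lforest g -> (renumber s g).1.2 ord_max = v ->
  contract Y g = (-1) ^+ s * Y (attach u (renumber s g)).
Proof.
move=> aY hg sv; rewrite /contract.
case: pickP => [t /eqP tv|/(_ s)]; last by rewrite sv eqxx.
have [t' et] : exists t', (s^-1 * t = lift_perm ord_max ord_max t')%g.
  apply: perm_fixing_max; rewrite permM; rewrite -[RHS](permKV t); congr (t _).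
  apply: (rootn_inj (g := LForest hg)); rewrite /rootn /=.
  by move: tv sv; rewrite !ffunE => -> ->.
have -> : t = (s * lift_perm ord_max ord_max t')%g by rewrite -et mulKVg.
rewrite -renumberM -renumber_attach aY ?is_lforest_attach ?is_lforest_renumber //.
rewrite odd_permM odd_lift_perm /= addbb /= signr_addb !mulrA; congr (_ * _).
by rewrite -mulrA -expr2 sqrr_sign mulr1.
Qed.

Lemma contract_nonroot n (Y : preforest n -> R) (g : preforest n.+1) :
  v \notin codom g.1.2 -> contract Y g = 0.
Proof.
move=> nv; rewrite /contract; case: pickP => // s /eqP sv.
by case/negP: nv; rewrite -sv ffunE codom_f.
Qed.

Lemma bring_root_last n (g : preforest n.+1) : v \in codom g.1.2 ->
  exists s : 'S_n.+1, (renumber s g).1.2 ord_max = v.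
Proof.
by case/codomP => i ->; exists (tperm i ord_max); rewrite ffunE tpermV tpermR.
Qed.

Lemma codom_renumber n (s : 'S_n) (g : preforest n) :
  codom (renumber s g).1.2 =i codom g.1.2.
Proof.
move=> x; apply/codomP/codomP => -[i ->]; first by rewrite ffunE; exists ((s^-1)%g i).
by exists (s i); rewrite ffunE permK.
Qed.

Lemma alternating_contract n (Y : preforest n -> R) :
  alternating Y -> alternating (contract Y).
Proof.
move=> aY s g hg; have [vg|vg] := boolP (v \in codom g.1.2); last first.
  by rewrite !contract_nonroot ?mulr0 // codom_renumber.
have [t tv] : exists t, (renumber t (renumber s g)).1.2 ord_max = v.
  by apply: bring_root_last; rewrite codom_renumber.
rewrite (contractE (s := t)) ?is_lforest_renumber //.
move: tv; rewrite renumberM => tv; rewrite (contractE (s := s * t)%g) //.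
by rewrite odd_permM signr_addb !mulrA -expr2 sqrr_sign mul1r.
Qed.

(** Only the term that detaches v itself survives, since v must be a root for
the contraction not to vanish. *)
Lemma dfun_contract_nonroot n (Y : preforest n.+1 -> R) (g : preforest n.+1) :
    alternating Y -> is_lforest g -> v \notin codom g.1.2 ->
  dfun (contract Y) g = Y (attach u (detach v g)).
Proof.
move=> aY hg vg; have gv : g.1.1 v != None by rewrite (succ_root (LForest hg)).
rewrite /dfun (bigD1 v) //= big1 ?addr0 => [|w /andP[gw wv]].
  rewrite (contractE (s := 1%g)) ?is_lforest_detach ?renumber1 ?last_root_detach //.
  by rewrite odd_perm1 mul1r.
apply: contract_nonroot; apply: contra vg => /codomP[i].
case: (unliftP ord_max i) => [j|] ->; rewrite ?lift_root_detach ?last_root_detach.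
  by move=> ->; rewrite codom_f.
by move=> vw; rewrite vw eqxx in wv.
Qed.

(** By alternation v may be taken to be the last root of g. Swapping the last
two roots identifies the terms of the left-hand side, up to sign, with the terms
of [dfun Y (attach u g)] other than the one that detaches v, which is Y g; and
the whole sum vanishes because Y is a cocycle. *)
Lemma dfun_contract_root n (Y : preforest n.+1 -> R) (g : preforest n.+1) :
    u != v -> alternating Y -> (forall h, loopless h -> dfun Y h = 0) ->
    loopless g -> v \in codom g.1.2 ->
  dfun (contract Y) g = Y g.
Proof.
move=> uv aY Y0 lg /bring_root_last[s].
have adK := alternating_dfun (alternating_contract aY).
have hg : is_lforest g by case/andP: lg.
suff E h : loopless h -> h.1.2 ord_max = v -> dfun (contract Y) h = Y h.
  move=> sv; have := E _ (loopless_renumber s lg) sv.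
  rewrite adK ?aY // => /(congr1 ( *%R ((-1) ^+ s))).
  by rewrite !mulrA -expr2 sqrr_sign !mul1r.
move=> lh hv; have hh : is_lforest h by case/andP: lh.
have hv0 : h.1.1 v = None.
  by apply/eqP; rewrite (succ_root (LForest hh)) -hv codom_f.
have := Y0 (attach u h); rewrite loopless_attach ?hv // => /(_ isT).
rewrite /dfun (bigD1 v) /=; last by rewrite ffunE hv eqxx.
rewrite -{1}hv detach_attach // => /eqP; rewrite addr_eq0 => /eqP ->.
rewrite -sumrN; apply: eq_big => [w|w hw].
  rewrite ffunE hv; case: (eqVneq w v) => [->|_]; first by rewrite hv0.
  by rewrite andbT.
have wv : w != v by apply: contraNneq hw => ->; rewrite hv0.
rewrite (contractE (s := swap_last n)) ?is_lforest_detach //; last first.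
  by rewrite ffunE swap_lastV tpermL lift_root_detach.
by rewrite odd_swap_last mulN1r attach_swap_detach ?hv.
Qed.

End Contraction.

(** The nodes are treated one by one. Replacing Y by Y - dfun (contract u v Y)
makes it vanish on the drawings where v is a root, and on the others replaces
Y g by the difference of Y g and of its value with v redirected to u. Redirecting
v leaves the other roots alone, so that vanishing obtained for earlier nodes is
kept. When all nodes are done nothing is left, as every drawing considered has
a root. A target u <> v exists because N >= 2, and it keeps the drawings
loopless. *)
Lemma dfun_exact_loopless n (X : preforest n.+1 -> R) :
    (2 <= N)%N -> alternating X -> (forall g, loopless g -> dfun X g = 0) ->
  exists2 Z, alternating Z & forall g, loopless g -> X g = dfun Z g.
Proof.
move=> hN aX X0.
suff [Z aZ XZ] : exists2 Z, alternating Z & forall g v, v \in enum 'I_N ->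
    loopless g -> v \in codom g.1.2 -> X g - dfun Z g = 0.
  exists Z => // g lg; apply/eqP; rewrite -subr_eq0.
  by rewrite (XZ g (g.1.2 ord_max)) ?mem_enum ?codom_f.
elim: (enum 'I_N) => [|v vs [Z aZ XZ]].
  by exists (fun=> 0) => // s g; rewrite mulr0.
(* The node v has a possible target: this fails for N = 1. *)
have [u uv] : exists u, u != v.
  case: (pickP (predC1 v)) => [u uv|none]; first by exists u.
  have := cardC1 v; rewrite (eq_card0 none) card_ord.
  by move=> N1; move: hN; rewrite -subn_gt0 subn1 -N1.
pose Y g := X g - dfun Z g.
have dfunB n' (A B : preforest n'.+1 -> R) g :
    dfun (fun h => A h - B h) g = dfun A g - dfun B g.
  by rewrite /dfun -sumrB.
have aY : alternating Y.
  by move=> s g hg; rewrite /Y aX ?alternating_dfun // mulrBr.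
have Y0 g : loopless g -> dfun Y g = 0.
  by move=> lg; rewrite dfunB X0 ?dfun_dfun ?subr0 //; case/andP: lg.
have aK := alternating_contract u v aY.
exists (fun g => Z g + contract u v Y g) => [s g hg|g w]; first by rewrite aZ ?aK ?mulrDr.
rewrite inE => wv lg wg; have hg : is_lforest g by case/andP: lg.
have -> : dfun (fun g => Z g + contract u v Y g) g = dfun Z g + dfun (contract u v Y) g.
  by rewrite /dfun big_split.
rewrite opprD addrA -/(Y g); have [vg|vg] := boolP (v \in codom g.1.2).
  by rewrite dfun_contract_root ?subrr.
have wv' : w \in vs by case/predU1P: wv vg => // <-; rewrite wg.
have gv : g.1.1 v != None by rewrite (succ_root (LForest hg)).
rewrite dfun_contract_nonroot // /Y (XZ g w) // (XZ _ w) ?subrr //.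
  by apply: loopless_attach; rewrite ?last_root_detach ?loopless_detach.
case/codomP: wg => i ->; apply/codomP; exists i.
by rewrite [RHS]ffunE lift_root_detach.
Qed.

End Cochains.
End RawForests.

(** * From functions on drawings to forms *)

Section Pushforward.
Variables (R : realType) (N p : nat).
Local Notation preforest n := (preforest N n p).
Local Notation lforest n := (lforest N n p).
Local Notation forest n := (forest N n p).
Local Notation span := (Defs.span R).
Local Notation basis := (@Defs.basis R _).
Local Open Scope quotient_scope.

Definition push n (X : preforest n -> R) : span (forest n) :=
  \sum_(g : lforest n) X (val g) *: basis (\pi_(forest n) g).

Lemma basisE (F : finType) (a b : F) : basis a b = (b == a)%:R :> R.
Proof. by rewrite Defs.basis.unlock ffunE. Qed.

Lemma push_coef n (X : preforest n -> R) a :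
  push X a = \sum_(g : lforest n | \pi_(forest n) g == a) X (val g).
Proof.
rewrite /push sum_ffunE [RHS]big_mkcond /=; apply: eq_bigr => g _.
rewrite ffunE basisE eq_sym /GRing.scale /=.
by case: eqP => _; rewrite ?mulr1 ?mulr0.
Qed.

(** Both sides are sums over the edges created: pairs of a drawing and a target
on the left, pairs of a drawing and a non-root node on the right. [attach] and
[detach] match them. *)
Lemma push_dfun n (X : preforest n.+1 -> R) :
  dHspan R N n p (push X) = push (dfun X).
Proof.
pose edge (q : lforest n.+1 * 'I_N) := (ladd_edge q.2 q.1, rootn q.1 ord_max).
have edge_inj : injective edge.
  move=> [g u] [h v] guhv; have r := congr1 snd guhv.
  have e : attach u (val g) = attach v (val h) := congr1 (val \o fst) guhv.
  have gh : g = h.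
    apply: val_inj; rewrite -[LHS](detach_attach u (lforestP g)).
    by rewrite -[RHS](detach_attach v (lforestP h)) e; congr (detach _ _).
  move: e; rewrite gh => /(congr1 (fun k : preforest n => k.1.1 (rootn h ord_max))).
  by rewrite /= !ffunE eqxx => -[->].
rewrite linear_sum.
under eq_bigr do rewrite linearZ /= dHspan_pi scaler_sumr.
rewrite (pair_bigA _ (fun g u => X (val g) *: basis (\pi_(forest n) (ladd_edge u g)))) /=.
rewrite /push; under [RHS]eq_bigr do rewrite /dfun scaler_suml.
rewrite (pair_big_dep xpredT (fun (g : lforest n) w => (val g).1.1 w != None)
  (fun g w => X (detach w (val g)) *: basis (\pi_(forest n) g))) /=.
(* The right-hand side now ranges over the image of edge. *)
rewrite (eq_bigl (mem (edge @: [set: lforest n.+1 * 'I_N]%SET))) => [|[b w]].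
  rewrite big_imset => [|? ? _ _ /edge_inj //].
  apply: eq_big => [q|q _]; first by rewrite inE.
  by rewrite /= (detach_attach _ (lforestP q.1)).
apply/idP/imsetP => /= [bw|[[g u] _ [-> ->]]]; last by rewrite ffunE eqxx.
case bwu: ((val b).1.1 w) bw => [u|//] _.
have hw : (val b).1.1 w != None by rewrite bwu.
exists (LForest (is_lforest_detach (lforestP b) hw), u); rewrite ?inE //.
rewrite /edge /rootn /= last_root_detach; congr (_, _); apply: val_inj.
by rewrite -[LHS](attach_detach bwu).
Qed.

Lemma lpermute_roots_inj n (s : 'S_n) : injective (@lpermute_roots N n p s).
Proof.
move=> g h gh; apply: val_inj.
have e : renumber s (val g) = renumber s (val h) := congr1 val gh.
by rewrite -[LHS]renumber1 -(mulgV s) -renumberM e renumberM mulgV renumber1.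
Qed.

Lemma act_roots_push n (s : 'S_n) (X : preforest n -> R) :
  alternating X -> act_roots R N p s (push X) = (-1) ^+ s *: push X.
Proof.
move=> aX; rewrite linear_sum scaler_sumr [RHS](reindex_inj (@lpermute_roots_inj n s)).
apply: eq_bigr => g _; rewrite linearZ /= act_roots_basis permute_roots_pi scalerA.
congr (_ *: _); have := aX s _ (lforestP g); rewrite /renumber /= => ->.
by rewrite mulrA -expr2 sqrr_sign mul1r.
Qed.

Lemma wedge_roots_alt n (x : span (forest n)) :
  (forall s : 'S_n, act_roots R N p s x = (-1) ^+ s *: x) ->
  wedge_roots R N n p x = x.
Proof.
move=> ax; rewrite wedge_rootsE scale_lfunE sum_lfunE (eq_bigr (fun=> x)) => [|s _].
  rewrite sumr_const card_Sn -scaler_nat scalerA mulVf ?scale1r //.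
  by rewrite pnatr_eq0 -lt0n fact_gt0.
by rewrite scale_lfunE ax scalerA -expr2 sqrr_sign scale1r.
Qed.

Lemma permute_coverticesM n s t (a : forest n) :
  permute_covertices s (permute_covertices t a) = permute_covertices (t * s)%g a.
Proof.
rewrite {2}/permute_covertices permute_covertices_pi; congr (\pi _).
by apply: lforest_eq => // i; rewrite /covn /= !ffunE invMg permM.
Qed.

Lemma act_coverticesM n (s t : 'S_p) x :
  act_covertices R N n s (act_covertices R N n t x) =
  act_covertices R N n (t * s)%g x.
Proof.
rewrite -[RHS]id_lfunE; move: x; apply: eq_span2 => a.
by rewrite id_lfunE (act_covertices_basis _ t) !act_covertices_basis permute_coverticesM.
Qed.

Lemma act_wedge_covertices n (t : 'S_p) x :
  act_covertices R N n t (wedge_covertices R N n p x) =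
  (-1) ^+ t *: wedge_covertices R N n p x.
Proof.
rewrite wedge_coverticesE !scale_lfunE !sum_lfunE linearZ /= linear_sum.
rewrite scalerA mulrC -scalerA.
congr (_ *: _); rewrite scaler_sumr [RHS](reindex_inj (mulIg t)) /=.
apply: eq_bigr => s _; rewrite !scale_lfunE linearZ /= act_coverticesM scalerA.
by rewrite odd_permM signr_addb mulrCA -expr2 sqrr_sign mulr1.
Qed.

(** Alternation in the covertices is not tracked on drawings: this
projection, which commutes with d_H and preserves loops, restores it. *)
Lemma wedge_covertices_idem n x :
  wedge_covertices R N n p (wedge_covertices R N n p x) = wedge_covertices R N n p x.
Proof.
rewrite {1}wedge_coverticesE scale_lfunE sum_lfunE.
rewrite (eq_bigr (fun=> wedge_covertices R N n p x)) => [|s _].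
  rewrite sumr_const card_Sn -scaler_nat scalerA mulVf ?scale1r //.
  by rewrite pnatr_eq0 -lt0n fact_gt0.
by rewrite scale_lfunE act_wedge_covertices scalerA -expr2 sqrr_sign scale1r.
Qed.

Lemma act_roots_Omega n (s : 'S_n) x :
  x \in Omega R N n p -> act_roots R N p s x = (-1) ^+ s *: x.
Proof. by case/memv_imgP=> y _ ->; rewrite comp_lfunE act_wedge_roots. Qed.

Lemma wedge_covertices_Omega n x :
  x \in Omega R N n p -> wedge_covertices R N n p x = x.
Proof.
by case/memv_imgP=> y _ ->; rewrite comp_lfunE wedgeC wedge_covertices_idem.
Qed.

Lemma wedge_covertices_loops n x :
  x \in loops R N n p -> wedge_covertices R N n p x \in loops R N n p.
Proof.
suff : (loops R N n p <= wedge_covertices R N n p @^-1: loops R N n p)%VS.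
  by move=> /subvP h /h; rewrite -memv_preim.
apply/span_subvP => y /mapP[a]; rewrite mem_enum => la ->.
rewrite -memv_preim linext_basis memvZ // memv_suml // => s _.
rewrite memvZ // memv_span //; apply: map_f; rewrite mem_enum.
by apply: etrans (has_loop_pi _) _.
Qed.

Lemma loops_coef n x (a : forest n) :
  x \in loops R N n p -> ~~ has_loop a -> x a = 0.
Proof.
move=> xl na; rewrite (coord_span (X := in_tuple _) xl) sum_ffunE big1 // => i _.
rewrite ffunE; have /mapP[b] := mem_nth 0 (ltn_ord i).
rewrite mem_enum => lb /= ->; rewrite basisE.
case: eqP => [ab|_]; last by rewrite /GRing.scale /= mulr0.
by move: lb na; rewrite -ab /in_mem /= => ->.
Qed.

Lemma loopless_val n (g : lforest n) : loopless (val g) = ~~ lhas_loop g.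
Proof. by rewrite /loopless (lforestP g) negb_exists. Qed.

Lemma permute_rootsK n (s : 'S_n) :
  cancel (@permute_roots N n p s) (permute_roots (s^-1)%g).
Proof.
move=> a; rewrite permute_rootsM mulgV -[RHS]reprK; congr (\pi _).
by apply: val_inj; apply: renumber1.
Qed.

(** An isomorphism class of forests may have several drawings on 'I_N, among
which an invariant lift shares the coefficient of the class evenly. *)
Definition class_size n (a : forest n) : nat :=
  #|[pred g : lforest n | \pi_(forest n) g == a]|.

Lemma class_size_neq0 n (g : lforest n) : class_size (\pi g) != 0.
Proof. by rewrite -lt0n; apply/card_gt0P; exists g; rewrite inE. Qed.

Lemma class_size_permute n (s : 'S_n) (a : forest n) :
  class_size (permute_roots s a) = class_size a.
Proof.
rewrite /class_size -!sum1_card (reindex_inj (@lpermute_roots_inj n s)).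
apply: eq_bigl => g; rewrite !inE -permute_roots_pi.
by rewrite (inj_eq (can_inj (@permute_rootsK n s))).
Qed.

Lemma sum_class n (a : forest n) (c : R) :
  \sum_(g : lforest n | \pi_(forest n) g == a) c = c * (class_size a)%:R.
Proof. by rewrite mulr_natr -sumr_const. Qed.

Definition invariant n (X : preforest n -> R) :=
  forall s (g h : lforest n), iso_by s g h -> X (val g) = X (val h).

(** The coefficient of each class is divided by its number of drawings. This lift
is constant on classes, so that a vanishing coefficient can be read back on the
drawings (see [push_loops_eq0]). *)
Lemma push_surj n x : (forall s : 'S_n, act_roots R N p s x = (-1) ^+ s *: x) ->
  exists X : preforest n -> R, [/\ alternating X, invariant X & x = push X].
Proof.
move=> ax.
pose f (g : lforest n) : R := x (\pi g) / (class_size (\pi g))%:R.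
pose X (g : preforest n) : R := oapp f 0 (insub g).
have XE g : X (val g) = f g by rewrite /X valK.
have x_perm s a : x (permute_roots s a) = (-1) ^+ s * x a.
  have -> : x a = act_roots R N p s x (permute_roots s a).
    rewrite lfunE /= /linext_fun sum_ffunE (bigD1 a) //= ffunE basisE eqxx.
    rewrite big1 => [|b /negbTE ba]; first by rewrite /GRing.scale /= mulr1 addr0.
    rewrite ffunE basisE (inj_eq (can_inj (@permute_rootsK n s))) eq_sym ba.
    by rewrite /GRing.scale /= mulr0.
  by rewrite ax ffunE /GRing.scale /= mulrA -expr2 sqrr_sign mul1r.
exists X; split.
- move=> s g hg; pose h := LForest hg.
  rewrite -[g]/(val h) -[renumber s _]/(val (lpermute_roots s h)) !XE /f.
  by rewrite -permute_roots_pi class_size_permute x_perm mulrA.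
- by move=> s g h gh; rewrite !XE /f (iso_pi gh).
apply/ffunP => a; rewrite push_coef.
rewrite (eq_bigr (fun=> x a / (class_size a)%:R)) => [|g /eqP ga]; last first.
  by rewrite XE /f ga.
have [g ga] : exists g : lforest n, \pi_(forest n) g = a.
  by exists (repr a); rewrite reprK.
by rewrite sum_class divfK // pnatr_eq0 -ga class_size_neq0.
Qed.

Lemma invariant_dfun n (X : preforest n.+1 -> R) : invariant X -> invariant (dfun X).
Proof.
move=> iX s g h gh; case/iso_byP: (gh) => h1 h2 h3.
rewrite /dfun [RHS](reindex_inj (@perm_inj _ s)) /=.
have gsh w : (succ h (s w) != None) = (succ g w != None).
  by rewrite h1; case: (succ g w).
apply: eq_big => [w|w gw]; first exact/esym/gsh.
have hw : succ h (s w) != None by rewrite gsh.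
apply: (iX s (LForest (is_lforest_detach (lforestP g) gw))
             (LForest (is_lforest_detach (lforestP h) hw))).
apply/iso_byP; split=> v //; rewrite /succ /rootn /=.
  by rewrite !ffunE (inj_eq perm_inj); case: eqP => // _; apply: h1.
case: (unliftP ord_max v) => [j|] ->; rewrite ?last_root_detach //.
by rewrite !lift_root_detach; apply: h2.
Qed.

(** The coefficient of a class in the pushforward of an invariant function is the
common value on its drawings times their number, which is nonzero in R. *)
Lemma push_loops_eq0 n (X : preforest n -> R) g :
  invariant X -> push X \in loops R N n p -> loopless g -> X g = 0.
Proof.
move=> iX pX lg; have hg : is_lforest g by case/andP: lg.
pose b := LForest hg; rewrite -[g]/(val b) in lg *.
have := loops_coef (a := \pi b) pX; rewrite has_loop_pi -loopless_val lg => /(_ isT).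
rewrite push_coef (eq_bigr (fun=> X (val b))) => [|h]; last first.
  by move=> /eqP/eqmodP/existsP[s]; apply: iX.
rewrite sum_class => /eqP; rewrite mulf_eq0 pnatr_eq0.
by rewrite (negbTE (class_size_neq0 b)) orbF => /eqP.
Qed.

Lemma dHspan_dHspan n x :
  x \in Omega R N n.+2 p -> dHspan R N n p (dHspan R N n.+1 p x) = 0.
Proof.
move=> xO; have [|X [aX _ ->]] := @push_surj _ x.
  by move=> s; apply: act_roots_Omega.
by rewrite !push_dfun; apply: big1 => g _; rewrite dfun_dfun ?scale0r // lforestP.
Qed.

(** A lift of x satisfies the hypotheses of [dfun_exact_loopless]; the
pushforward of the function Z found there is alternating in the roots, and
[wedge_covertices] makes it alternating in the covertices without changing the
class of its derivative. *)
Lemma dHspan_exact_mod_loops n x : (2 <= N)%N ->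
  x \in Omega R N n.+1 p -> dHspan R N n p x \in loops R N n p ->
  exists2 z, z \in Omega R N n.+2 p & x - dHspan R N n.+1 p z \in loops R N n.+1 p.
Proof.
move=> hN xO; have [|X [aX iX xX]] := @push_surj _ x.
  by move=> s; apply: act_roots_Omega.
rewrite {1}xX push_dfun => lX.
have [|Z aZ XZ] := dfun_exact_loopless hN aX.
  by move=> g lg; apply: push_loops_eq0 lX lg; apply: invariant_dfun.
exists (wedge_covertices R N n.+2 p (push Z)).
  rewrite -[push Z]wedge_roots_alt => [|s]; last exact: act_roots_push.
  by rewrite -wedgeC -comp_lfunE memv_img ?memvf.
rewrite -[x]wedge_covertices_Omega // -wedge_covertices_dHspan -linearB.
apply: wedge_covertices_loops; rewrite xX push_dfun /push -sumrB.
apply: memv_suml => g _; rewrite -scalerBl.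
have [lg|lg] := boolP (loopless (val g)); first by rewrite XZ ?subrr ?scale0r ?mem0v.
apply/memvZ/memv_span/map_f; rewrite mem_enum.
by apply: etrans (has_loop_pi _) _; rewrite -[lhas_loop g]negbK -loopless_val.
Qed.

End Pushforward.

Local Open Scope classical_set_scope.

Theorem theorem2p11 (R : realType) (N n p : nat) (hN : (2 <= N)%N) :
  [set x : df_form R N n.+1 p | dH_df x = 0] =
  @df_pi R N n.+1 p @` [set w : aromatic_form R N n.+1 p | dH w = 0].
Proof.
apply/seteqP; split=> [x /= x0|_ /= [w w0 <-]]; last first.
  by rewrite dH_df_pi w0 linear0.
have [w xw] := df_pi_surj x; move: x0; rewrite xw dH_df_pi => /eqP.
rewrite df_pi_eq0 mem_loop_form => lw.
have [z zO wz] := dHspan_exact_mod_loops hN (subvsP w) lw.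
exists (Subvs (dHspan_Omega zO)).
  by apply: val_inj; rewrite /= dHspan_dHspan.
apply/esym/eqP; rewrite -subr_eq0 -linearB df_pi_eq0 mem_loop_form.
by rewrite linearB.
Qed.
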